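(* A matroid $N$ is an induced restriction of a matroid $M$ if and only if $N^*$ is a cc-minor of $M^*$.
   Context: Matroids are finite; $M^*$ denotes the dual of $M$. An induced restriction of a matroid $M$ is a matroid obtained from $M$ by restricting to a flat of $M$. A matroid $N$ is a circuit-contraction minor (cc-minor) of a matroid $M$ if there is a sequence $M_0,M_1,\dots,M_n$ of matroids ($n\ge 0$) such that $(M_0,M_n)=(M,N)$ and, for each $i\in\{1,\dots,n\}$, there is a circuit $C_{i-1}$ of $M_{i-1}$ with $M_i=M_{i-1}/C_{i-1}$. *)

(* Defs.v *)
From mathcomp Require Import all_boot.
From mathcomp Require Import zify.

Set Implicit Arguments.
Unset Strict Implicit.
Unset Printing Implicit Defensive.

(* The ground set is a subset of an ambient finite type T, so that a matroid  *)
(* and all its minors have the same type.  The independence axioms are        *)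
(* boolean, hence proof irrelevant: two matroids are Leibniz equal as soon as *)
(* they have the same ground set and the same independent sets.               *)

Definition matroid_axioms (T : finType) (E : {set T}) (I : {set {set T}}) :=
  [&& I \subset powerset E,
      set0 \in I,
      [forall A in I, forall B : {set T}, (B \subset A) ==> (B \in I)] &
      [forall A in I, forall B in I,
         (#|A| < #|B|) ==> [exists x in B :\: A, x |: A \in I]]].

Record matroid (T : finType) := Matroid {
  ground : {set T};
  indep : {set {set T}};
  matroidP : matroid_axioms ground indep
}.

Section Matroids.

Variable T : finType.
Implicit Types (M N : matroid T) (A B C F X Y : {set T}).

Lemma matroid_axiomsP (E : {set T}) (I : {set {set T}}) :
  reflect
    [/\ {in I, forall A, A \subset E},
        set0 \in I,
        (forall A B, A \in I -> B \subset A -> B \in I) &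
        (forall A B, A \in I -> B \in I -> #|A| < #|B| ->
           exists2 x, x \in B :\: A & x |: A \in I)]
    (matroid_axioms E I).
Proof.
apply: (iffP and4P) => -[IE I0 Isub Iaug]; split=> //.
- by move=> A /(subsetP IE); rewrite powersetE.
- by move=> A B AI; move/forall_inP/(_ A AI)/forallP/(_ B)/implyP: Isub.
- move=> A B AI BI ltAB.
  move/forall_inP/(_ A AI)/forall_inP/(_ B BI)/implyP/(_ ltAB): Iaug.
  by case/exists_inP=> x xBA xAI; exists x.
- by apply/subsetP=> A /IE; rewrite powersetE.
- by apply/forall_inP=> A AI; apply/forallP=> B; apply/implyP; apply: Isub.
- apply/forall_inP=> A AI; apply/forall_inP=> B BI; apply/implyP=> ltAB.
  by have [x xBA xAI] := Iaug A B AI BI ltAB; apply/exists_inP; exists x.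
Qed.

Definition base M B := maxset [pred X : {set T} | X \in indep M] B.

Definition circuit M C :=
  minset [pred X : {set T} | (X \subset ground M) && (X \notin indep M)] C.

Definition rank M X := \max_(A in indep M | A \subset X) #|A|.

Definition closure M X := [set x in ground M | rank M (x |: X) == rank M X].

Definition flat M F := closure M F == F.

Lemma restrict_axioms M X :
  matroid_axioms (ground M :&: X) [set A in indep M | A \subset X].
Proof.
have /matroid_axiomsP[ME M0 Msub Maug] := matroidP M.
apply/matroid_axiomsP; split.
- by move=> A; rewrite inE => /andP[/ME AE AX]; rewrite subsetI AE.
- by rewrite inE M0 sub0set.
- move=> A B; rewrite !inE => /andP[AI AX] BA.
  by rewrite (Msub A) // (subset_trans BA).
- move=> A B; rewrite !inE => /andP[AI AX] /andP[BI BX] ltAB.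
  have [x xBA xAI] := Maug _ _ AI BI ltAB; exists x => //.
  rewrite inE xAI subUset sub1set AX andbT.
  by move: xBA; rewrite inE => /andP[_ /(subsetP BX)].
Qed.

Definition restrict M X := Matroid (restrict_axioms M X).

Definition delete M X := restrict M (ground M :\: X).

Lemma indep_extend M A B : A \in indep M -> B \in indep M ->
  exists D, [/\ D \in indep M, A \subset D, D \subset A :|: B & #|B| <= #|D|].
Proof.
have /matroid_axiomsP[_ _ _ Maug] := matroidP M => AI BI.
have PA : [pred X : {set T} | (X \in indep M) && (X \subset A :|: B)] A.
  by rewrite /= AI subsetUl.
have [D /maxsetP[/= /andP[DI DAB] Dmax] AD] := maxset_exists PA.
exists D; split=> //; rewrite leqNgt; apply/negP => ltDB.
have [x /setDP[xB xD] xDI] := Maug _ _ DI BI ltDB.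
have DxD : x |: D = D.
  by apply: Dmax; rewrite ?subsetUr // xDI subUset DAB sub1set inE xB orbT.
by rewrite -DxD setU11 in xD.
Qed.

Lemma baseP M B :
  reflect (B \in indep M /\ {in indep M, forall A, #|A| <= #|B|}) (base M B).
Proof.
have /matroid_axiomsP[_ _ _ Maug] := matroidP M.
apply: (iffP maxsetP) => /= -[BI Bmax]; split=> //.
  move=> A AI; have [D [DI BD _ leAD]] := indep_extend BI AI.
  by rewrite -(Bmax D DI BD).
by move=> A AI BA; apply/esym/eqP; rewrite eqEcard BA Bmax.
Qed.

Lemma dual_axioms M :
  matroid_axioms (ground M)
    [set X : {set T} | [exists B, base M B && (X \subset ground M :\: B)]].
Proof.
have /matroid_axiomsP[ME M0 Msub _] := matroidP M.
apply/matroid_axiomsP; split.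
- by move=> A; rewrite inE => /existsP[B /andP[_]]; rewrite subsetD => /andP[].
- rewrite inE; have [B Bmax _] := @maxset_exists _ [pred X : {set T} | X \in indep M] _ M0.
  by apply/existsP; exists B; rewrite /base Bmax sub0set.
- move=> X Y; rewrite !inE => /existsP[B /andP[Bb XB]] YX.
  by apply/existsP; exists B; rewrite Bb (subset_trans YX).
move=> X Y; rewrite !inE => /existsP[B' /andP[/baseP[B'I B'max] XB']].
case/existsP=> B /andP[/baseP[BI Bmax] YB] ltXY.
have BXI : B :\: X \in indep M by apply: Msub BI (subsetDl _ _).
have [D [DI BXD DB leB'D]] := indep_extend BXI B'I.
move: XB' YB; rewrite !subsetD => /andP[XE dXB'] /andP[YE dYB].
have Dmax A : A \in indep M -> #|A| <= #|D|.
  by move=> AI; apply: leq_trans leB'D; apply: B'max.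
have dXD : [disjoint X & D].
  rewrite disjoint_subset; apply/subsetP=> x xX; rewrite inE.
  by apply/negP=> /(subsetP DB); rewrite !inE xX (disjointFr dXB' xX).
have /subsetPn[y yYX yD] : ~~ (Y :\: X \subset D).
  apply/negP => YXD.
  have sUD : (B :\: X) :|: (Y :\: X) \subset D by rewrite subUset BXD.
  have := subset_leq_card sUD.
  have /eqP dBY : (B :\: X) :&: (Y :\: X) == set0.
    by rewrite setI_eq0; rewrite disjoint_sym; apply: disjointW dYB; exact: subsetDl.
  rewrite cardsU dBY cards0 subn0 => leD.
  have leBX : #|B :&: X| <= #|X :\: Y|.
    apply/subset_leq_card/subsetP=> x /setIP[xB xX].
    by rewrite inE xX andbT; apply/negP=> xY; rewrite (disjointFr dYB xY) in xB.
  have := Bmax _ DI; have := cardsID X B; have := cardsID X Y.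
  have := cardsID Y X; rewrite (setIC X Y); lia.
exists y => //; move/setDP: yYX => [yY yX].
rewrite inE; apply/existsP; exists D; apply/andP; split.
  by apply/baseP; split=> // A; apply: Dmax.
rewrite subUset sub1set inE yD (subsetP YE _ yY) /= subsetD XE.
exact: dXD.
Qed.

Definition dual M := Matroid (dual_axioms M).

(* This is Oxley's definition of contraction, M / X := (M^* \ X)^*. *)
Definition contract M X := dual (delete (dual M) X).

Definition induced_restriction N M :=
  exists2 F, flat M F & N = restrict M F.

Definition cc_minor N M :=
  exists (n : nat) (Ms : nat -> matroid T),
    [/\ Ms 0 = M, Ms n = N &
        forall i, i < n ->
          exists2 C, circuit (Ms i) C & Ms i.+1 = contract (Ms i) C].

End Matroids.

(* Main.v *)
Require Import Defs.
From mathcomp Require Import all_boot.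

(** Dualising turns contractions into deletions: the contraction of [dual M] by
    [C] is the dual of [M] restricted to the complement of [C].  If [C] is a
    circuit of [dual M], this complement is a hyperplane of [M], that is, a
    maximal non-spanning set, and every hyperplane arises in this way
    ([circuit_dual_hyperplane], [hyperplane_circuit_dual]).  The cc-minors of
    [dual M] are therefore the duals of the matroids obtained from [M] by
    repeatedly restricting to a hyperplane of the current matroid, and it
    remains to see that these are the restrictions of [M] to its flats.

    In one direction, hyperplanes are flats ([hyperplane_flat]), and a flat of a
    restriction to a flat is a flat of the whole matroid
    ([induced_restriction_trans]), because any element spanned by a subset of a
    flat lies in that flat ([span_mono]).  In the other direction, a flat other
    than the ground set is non-spanning, hence lies in some hyperplane
    ([flat_sub_hyperplane]); it is still a flat of the restriction to that
    hyperplane, so induction on the size of the ground set applies. *)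

(** * Equality and duality *)

Lemma setDK {T : finType} {E X : {set T}} : X \subset E -> E :\: (E :\: X) = X.
Proof. by move=> XE; rewrite setDDr setDv set0U (setIidPr XE). Qed.

Lemma matroid_eq (T : finType) (M N : matroid T) :
  ground M = ground N -> indep M = indep N -> M = N.
Proof.
case: M N => [E I MP] [E' I' NP] /= eqE eqI.
by case: _ / eqE NP; case: _ / eqI => NP; rewrite (bool_irrelevance MP NP).
Qed.

Lemma indep_sub_ground {T : finType} {M : matroid T} {A : {set T}} :
  A \in indep M -> A \subset ground M.
Proof. by have /matroid_axiomsP[ME _ _ _] := matroidP M; apply: ME. Qed.

Lemma indep0 (T : finType) (M : matroid T) : set0 \in indep M.
Proof. by have /matroid_axiomsP[] := matroidP M. Qed.

Lemma indepS {T : finType} {M : matroid T} {A B : {set T}} :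
  A \subset B -> B \in indep M -> A \in indep M.
Proof.
by have /matroid_axiomsP[_ _ Msub _] := matroidP M => AB BI; apply: Msub BI AB.
Qed.

Lemma indep_sub_base {T : finType} {M : matroid T} {A : {set T}} :
  A \in indep M -> exists2 B, base M B & A \subset B.
Proof.
move=> AI; have [B Bb AB] := @maxset_exists _ [pred X | X \in indep M] _ AI.
by exists B.
Qed.

Lemma indep_dualP {T : finType} {M : matroid T} {X : {set T}} :
  reflect (exists2 B, base M B & X \subset ground M :\: B)
          (X \in indep (dual M)).
Proof. by rewrite inE; apply: (iffP exists_inP). Qed.

(** Complements of bases are exactly the bases of the dual: all of them have the
    same size, so none is properly contained in another. *)
Lemma base_dualP {T : finType} {M : matroid T} {X : {set T}} :
  reflect (exists2 B, base M B & X = ground M :\: B) (base (dual M) X).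
Proof.
apply: (iffP idP).
  case/maxsetP=> /indep_dualP[B Bb XB] Xmax; exists B => //.
  by apply/esym/Xmax => //; apply/indep_dualP; exists B.
case=> B Bb ->; have [BI Bmax] := baseP _ _ Bb.
apply/baseP; split; first by apply/indep_dualP; exists B.
move=> A /indep_dualP[B' Bb' AB']; have [B'I B'max] := baseP _ _ Bb'.
apply: leq_trans (subset_leq_card AB') _.
rewrite !cardsD (setIidPr (indep_sub_ground BI)).
by rewrite (setIidPr (indep_sub_ground B'I)) leq_sub2l ?B'max.
Qed.

Lemma dualK (T : finType) (M : matroid T) : dual (dual M) = M.
Proof.
have compK B : base M B -> ground M :\: (ground M :\: B) = B.
  by case/baseP=> /indep_sub_ground BE _; apply: setDK.
apply: matroid_eq => //; apply/setP=> X; apply/indep_dualP/idP.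
  case=> _ /base_dualP[B Bb ->]; rewrite /= compK // => XB.
  by have [BI _] := baseP _ _ Bb; apply: indepS XB BI.
move=> XI; have [B Bb XB] := indep_sub_base XI.
by exists (ground M :\: B); [apply/base_dualP; exists B | rewrite /= compK].
Qed.

(** * Rank and flats *)

Lemma card_leq_rank {T : finType} {M : matroid T} {A X : {set T}} :
  A \in indep M -> A \subset X -> #|A| <= rank M X.
Proof. by move=> AI AX; apply: (@leq_bigmax_cond _ _ (fun A : {set T} => #|A|)); rewrite AI. Qed.

Lemma rank_witness {T : finType} (M : matroid T) (X : {set T}) :
  exists A, [/\ A \in indep M, A \subset X & #|A| = rank M X].
Proof.
have P0 : 0 < #|[pred A : {set T} | (A \in indep M) && (A \subset X)]|.
  by apply/card_gt0P; exists set0; rewrite inE indep0 sub0set.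
have [A /andP[AI AX] rA] := eq_bigmax_cond (fun A : {set T} => #|A|) P0.
by exists A; split.
Qed.

Lemma rankS {T : finType} (M : matroid T) {X Y : {set T}} :
  X \subset Y -> rank M X <= rank M Y.
Proof.
have [A [AI AX <-]] := rank_witness M X => XY.
exact: card_leq_rank AI (subset_trans AX XY).
Qed.

(** Proved contrapositively: if [x] raises the rank of [Y], it can be added to a
    maximal independent subset of [Y]; taking this subset to extend a maximal
    independent subset of [X], the same [x] raises the rank of [X]. *)
Lemma span_mono {T : finType} {M : matroid T} {X Y : {set T}} {x : T} :
  X \subset Y -> rank M (x |: X) = rank M X -> rank M (x |: Y) = rank M Y.
Proof.
move=> XY rX; apply/eqP; rewrite eqn_leq (rankS M (subsetUr _ _)) andbT leqNgt.
apply/negP=> ltY.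
have [A [AI AX cA]] := rank_witness M X.
have [B [BI BY cB]] := rank_witness M Y.
have [D [DI AD DAB leBD]] := indep_extend AI BI.
have DY : D \subset Y by rewrite (subset_trans DAB) // subUset BY (subset_trans AX).
have [K [KI KY cK]] := rank_witness M (x |: Y).
have /matroid_axiomsP[_ _ _ Maug] := matroidP M.
have ltDK : #|D| < #|K|.
  by rewrite cK (leq_ltn_trans _ ltY) // card_leq_rank.
have [y /setDP[yK yD] yDI] := Maug _ _ DI KI ltDK.
have yY : y \notin Y.
  apply/negP=> yY; have yDY : y |: D \subset Y by rewrite subUset sub1set yY.
  by have := card_leq_rank yDI yDY; rewrite cardsU1 yD add1n -cB ltnNge leBD.
have yx : y = x.
  by apply/eqP; move/subsetP/(_ y yK): KY; rewrite !inE (negPf yY) orbF.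
have yAI : y |: A \in indep M by apply: indepS (setUS _ AD) yDI.
have := card_leq_rank yAI (setUS [set y] AX).
rewrite cardsU1 cA {2}yx rX.
by rewrite (contra (subsetP AD y) yD) add1n ltnn.
Qed.

Lemma flatP {T : finType} {M : matroid T} {F : {set T}} :
  reflect (F \subset ground M /\
           forall x, x \in ground M -> rank M (x |: F) = rank M F -> x \in F)
          (flat M F).
Proof.
apply: (iffP eqP) => [clF|[FE Fcl]].
  split=> [|x xE rF]; last by rewrite -clF inE xE rF eqxx.
  by rewrite -clF; apply/subsetP=> x; rewrite inE => /andP[].
apply/setP=> x; rewrite inE; apply/andP/idP => [[xE /eqP]|xF]; first exact: Fcl.
by rewrite (subsetP FE) // (setUidPr _) ?sub1set.
Qed.

Lemma rank_restrict {T : finType} (M : matroid T) {F X : {set T}} :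
  X \subset F -> rank (restrict M F) X = rank M X.
Proof.
move=> XF; apply: eq_bigl => A; rewrite !inE -andbA; congr (_ && _).
by case: (boolP (A \subset X)) => [/subset_trans->|]; rewrite ?andbF.
Qed.

Lemma restrict_ground (T : finType) (M : matroid T) : restrict M (ground M) = M.
Proof.
apply: matroid_eq; first exact: setIid.
by apply/setP=> A; rewrite inE; case: (boolP (A \in _)) => // /indep_sub_ground.
Qed.

Lemma restrict_restrict {T : finType} (M : matroid T) {F G : {set T}} :
  G \subset F -> restrict (restrict M F) G = restrict M G.
Proof.
move=> GF; apply: matroid_eq; first by rewrite /= -setIA (setIidPr GF).
apply/setP=> A; rewrite !inE -andbA; congr (_ && _).
by case: (boolP (A \subset G)) => [/subset_trans->|]; rewrite ?andbF.
Qed.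

Lemma flat_restrict {T : finType} {M : matroid T} {F H : {set T}} :
  F \subset H -> flat M F -> flat (restrict M H) F.
Proof.
move=> FH /flatP[FE Fcl]; apply/flatP; split; first by rewrite subsetI FE.
move=> x /setIP[xE xH]; rewrite !rank_restrict ?subUset ?sub1set ?xH //.
exact: Fcl.
Qed.

Lemma induced_restriction_trans {T : finType} {M N : matroid T} {F : {set T}} :
  flat M F -> induced_restriction N (restrict M F) -> induced_restriction N M.
Proof.
move=> /flatP[FE Fcl] [G /flatP[GEF Gcl] ->].
have /andP[GE GF] : (G \subset ground M) && (G \subset F) by rewrite -subsetI.
exists G; last exact: restrict_restrict.
apply/flatP; split=> // x xE rG.
have xF : x \in F by apply: Fcl (span_mono GF rG).
by apply: Gcl; rewrite ?inE ?xE // !rank_restrict ?subUset ?sub1set ?xF.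
Qed.

(** * Hyperplanes and cocircuits *)

(** Hyperplanes are usually defined as maximal proper flats.  Defining them as
    maximal non-spanning sets makes them complementary to the minimal dependent
    sets of the dual, with no mention of closures. *)
Definition hyperplane {T : finType} (M : matroid T) (H : {set T}) :=
  maxset [pred X : {set T} |
    (X \subset ground M) && (rank M X < rank M (ground M))] H.

(** By maximality, adding an outside element to a hyperplane yields a spanning
    set, hence raises the rank. *)
Lemma hyperplane_flat {T : finType} {M : matroid T} {H : {set T}} :
  hyperplane M H -> flat M H.
Proof.
case/maxsetP=> /andP[HE ltH] Hmax; apply/flatP; split=> // x xE rH.
by rewrite -(Hmax (x |: H)) ?setU11 ?subsetUr //= subUset sub1set xE HE rH.
Qed.

Lemma flat_sub_hyperplane {T : finType} {M : matroid T} {F : {set T}} :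
  flat M F -> F != ground M -> exists2 H, hyperplane M H & F \subset H.
Proof.
move=> /flatP[FE Fcl] neF.
have PF : [pred X : {set T} |
    (X \subset ground M) && (rank M X < rank M (ground M))] F.
  rewrite /= FE ltnNge; apply: contra neF => leF.
  rewrite eqEsubset FE; apply/subsetP=> x xE; apply: Fcl => //.
  apply/eqP; rewrite eqn_leq (rankS M (subsetUr _ _)) andbT.
  by apply: leq_trans leF; rewrite rankS // subUset sub1set xE.
by have [H Hm FH] := maxset_exists PF; exists H.
Qed.

(** Both sides say that the complement of [X] contains a base of [M]. *)
Lemma indep_dual_spanning {T : finType} (M : matroid T) (X : {set T}) :
  X \subset ground M ->
  (X \in indep (dual M)) = (rank M (ground M) <= rank M (ground M :\: X)).
Proof.
move=> XE; apply/indep_dualP/idP => [[B /baseP[BI Bmax] XB]|leX].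
  have [A [AI _ <-]] := rank_witness M (ground M).
  apply: leq_trans (Bmax _ AI) (card_leq_rank BI _).
  move: XB; rewrite !subsetD (indep_sub_ground BI) => /andP[_].
  by rewrite disjoint_sym.
have [B [BI BX cB]] := rank_witness M (ground M :\: X).
exists B.
  apply/baseP; split=> // A AI; rewrite cB (leq_trans _ leX) //.
  exact: card_leq_rank AI (indep_sub_ground AI).
by move: BX; rewrite !subsetD XE => /andP[_]; rewrite disjoint_sym.
Qed.

(** Complementation reverses inclusion and exchanges the dependent sets of the
    dual with the non-spanning sets, so it exchanges the minimal members of one
    family with the maximal members of the other. *)
Lemma circuit_dual_hyperplane {T : finType} {M : matroid T} {C : {set T}} :
  circuit (dual M) C -> hyperplane M (ground M :\: C).
Proof.
case/minsetP=> /andP[/= CE]; rewrite indep_dual_spanning // -ltnNge => ltC Cmin.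
apply/maxsetP; split=> /= [|X /andP[XE ltX] CX]; first by rewrite subsetDl.
rewrite -(Cmin (ground M :\: X)) ?setDK //=.
  by rewrite subsetDl indep_dual_spanning ?subsetDl // (setDK XE) -ltnNge.
by rewrite subDset setUC -subDset.
Qed.

Lemma hyperplane_circuit_dual {T : finType} {M : matroid T} {H : {set T}} :
  hyperplane M H -> circuit (dual M) (ground M :\: H).
Proof.
case/maxsetP=> /andP[/= HE ltH] Hmax.
apply/minsetP; split=> /= [|X /andP[XE]].
  by rewrite subsetDl indep_dual_spanning ?subsetDl // (setDK HE) -ltnNge.
rewrite indep_dual_spanning // -ltnNge => ltX XH.
rewrite -(Hmax (ground M :\: X)) ?setDK //= ?subsetDl //.
by rewrite -(setDK HE) setDS.
Qed.

(** * Circuit-contraction minors *)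

Lemma dual_contract (T : finType) (M : matroid T) (C : {set T}) :
  dual (contract M C) = restrict (dual M) (ground M :\: C).
Proof. exact: dualK. Qed.

Lemma cc_minor_refl (T : finType) (M : matroid T) : cc_minor M M.
Proof. by exists 0, (fun=> M); split. Qed.

Lemma cc_minor_step {T : finType} {M N : matroid T} {C : {set T}} :
  circuit M C -> cc_minor N (contract M C) -> cc_minor N M.
Proof.
move=> MC [n [Ms [Ms0 Msn step]]].
exists n.+1, (fun i => if i is j.+1 then Ms j else M); split=> // -[|i] ltin.
  by exists C.
exact: step.
Qed.

(** Peeling contractions off the front of the sequence, so that the property is
    transported back from [N] to [M] while the target [N] stays fixed. *)
Lemma cc_minor_elim (T : finType) (N : matroid T) (P : matroid T -> Prop) :
  P N -> (forall M C, circuit M C -> P (contract M C) -> P M) ->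
  forall M, cc_minor N M -> P M.
Proof.
move=> PN Pstep M [n [Ms [Ms0 Msn step]]].
elim: n Ms M Ms0 Msn step => [|n IHn] Ms M Ms0 Msn step.
  by rewrite -Ms0 Msn.
have [C MC Ms1] := step 0 isT; rewrite Ms0 in MC Ms1.
apply: Pstep MC _; apply: (IHn (fun i => Ms i.+1)) => // i ltin.
exact: (step i.+1).
Qed.

(** Contracting the complement of a hyperplane [H] containing [F] replaces [M] by
    its restriction to [H], which has a smaller ground set and in which [F] is
    still a flat. *)
Lemma induced_restriction_cc_minor (T : finType) (M : matroid T) (F : {set T}) :
  flat M F -> cc_minor (dual (restrict M F)) (dual M).
Proof.
have [n] := ubnP #|ground M|; elim: n M => // n IHn M ltMn Ffl.
have [->|neF] := eqVneq F (ground M).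
  by rewrite restrict_ground; apply: cc_minor_refl.
have [H Hh FH] := flat_sub_hyperplane Ffl neF.
have /maxsetP[/andP[/= HE ltH] _] := Hh.
apply: (cc_minor_step (hyperplane_circuit_dual Hh)).
rewrite -[contract _ _]dualK dual_contract dualK /=.
rewrite (setDK HE) -(restrict_restrict M FH).
apply: IHn; last exact: flat_restrict.
rewrite /= (setIidPr HE); apply: leq_trans (ltMn : #|_| <= n).
(* A hyperplane is non-spanning, hence a proper subset of the ground set. *)
apply: proper_card; rewrite properEneq HE andbT.
by apply: contraTneq ltH => ->; rewrite ltnn.
Qed.

Lemma cc_minor_induced_restriction (T : finType) (M N : matroid T) :
  cc_minor N M -> induced_restriction (dual N) (dual M).
Proof.
apply: (@cc_minor_elim T N (fun L => induced_restriction (dual N) (dual L))).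
  exists (ground (dual N)); last by rewrite restrict_ground.
  by apply/flatP; split.
move=> L C LC; rewrite dual_contract; apply: induced_restriction_trans.
apply: (@hyperplane_flat _ (dual L) (ground L :\: C)).
by apply: (@circuit_dual_hyperplane _ (dual L)); rewrite dualK.
Qed.

Theorem proposition1p6 (T : finType) (M N : matroid T) :
  induced_restriction N M <-> cc_minor (dual N) (dual M).
Proof.
split=> [[F Ffl ->]|/cc_minor_induced_restriction].
  exact: induced_restriction_cc_minor.
by rewrite !dualK.
Qed.
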